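(* (i) Let $(\nabla,\ast,E)$ be a Saito structure on a complex manifold $M$ with unit $e$, such that the open set $M_0=\{p\in M \mid E\ast : T_pM\to T_pM \text{ is invertible}\}$ is nonempty. Let $r\in\mathbb{C}$ and let $(\boldsymbol{\nabla}^{(0,r)},\star_0,e)$ be the dual almost Saito structure with parameter $r$ of $(\nabla,\ast,E)$ (defined on $M_0$). Then the dual Saito structure of $(\boldsymbol{\nabla}^{(0,r)},\star_0,e)$ is $(\nabla,\ast,E)$ (on $M_0$). (ii) Let $(\boldsymbol{\nabla},\star,e)$ be an almost Saito structure on a complex manifold $N$ with parameter $r\in\mathbb{C}$ and unit $E$, such that the open set $N_0=\{p\in N\mid e\star :T_pN\to T_pN\text{ is invertible}\}$ is nonempty. Let $(\nabla,\ast,E)$ be its dual Saito structure (defined on $N_0$). Then the dual almost Saito structure of $(\nabla,\ast,E)$ with parameter $r$ is $(\boldsymbol{\nabla},\star,e)$ (on $N_0$).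
   Context: Manifolds are complex manifolds, $\mathcal{T}_M$ is the sheaf of holomorphic vector fields on $M$, connections are holomorphic, and a multiplication on $TM$ is an $\mathcal{O}_M$-bilinear map $\mathcal{T}_M\times\mathcal{T}_M\to\mathcal{T}_M$. A Saito structure $(\nabla,\ast,E)$ on $M$ consists of a torsion-free flat connection $\nabla$ on $TM$, an associative commutative multiplication $\ast$ on $TM$ with a unit vector field $e$, and a global vector field $E$, such that for all $x,y,z\in\mathcal{T}_M$: (SS1) $\nabla_x(y\ast z)-y\ast\nabla_xz-\nabla_y(x\ast z)+x\ast\nabla_yz=[x,y]\ast z$; (SS2) $[E,x\ast y]-[E,x]\ast y-x\ast[E,y]=x\ast y$; (SS3) $\nabla e=0$; (SS4) $\nabla_x\nabla_yE-\nabla_{\nabla_xy}E=0$. An almost Saito structure $(\boldsymbol{\nabla},\star,e)$ on $N$ with parameter $r\in\mathbb{C}$ consists of a torsion-free flat connection $\boldsymbol{\nabla}$ on $TN$, an associative commutative multiplication $\star$ on $TN$ with a unit vector field $E$, and a nonzero global vector field $e$, such that for all $x,y,z\in\mathcal{T}_N$: (ASS1) $\boldsymbol{\nabla}_x(y\star z)-y\star\boldsymbol{\nabla}_xz-\boldsymbol{\nabla}_y(x\star z)+x\star\boldsymbol{\nabla}_yz=[x,y]\star z$; (ASS2) $[e,x\star y]-[e,x]\star y-x\star[e,y]+e\star x\star y=0$; (ASS3) $\boldsymbol{\nabla}_xE=rx$; (ASS4) $\boldsymbol{\nabla}_x\boldsymbol{\nabla}_ye-\boldsymbol{\nabla}_{\boldsymbol{\nabla}_xy}e+\boldsymbol{\nabla}_{x\star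 y}e=0$. Dual almost Saito structure: for a Saito structure $(\nabla,\ast,E)$ with unit $e$ put $\mathcal{U}_0(x)=E\ast x$; the dual almost Saito structure with parameter $r$ is $(\boldsymbol{\nabla}^{(0,r)},\star_0,e)$ on $M_0$, where $x\star_0y=\mathcal{U}_0^{-1}(x\ast y)$ and $\boldsymbol{\nabla}^{(0,r)}_xy=\nabla_xy+r\,x\star_0y-\nabla_{x\star_0y}E$ (this is an almost Saito structure with parameter $r$ and unit $E$). Dual Saito structure: for an almost Saito structure $(\boldsymbol{\nabla},\star,e)$ with unit $E$ put $\mathcal{P}(x)=e\star x$; the dual Saito structure is $(\nabla,\ast,E)$ on $N_0$, where $x\ast y=\mathcal{P}^{-1}(x\star y)$ and $\nabla_xy=\boldsymbol{\nabla}_xy-\boldsymbol{\nabla}_{x\ast y}e$ (this is a Saito structure with unit $e$). *)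

(* Defs.v *)
From mathcomp Require Import all_boot all_order all_algebra.
From mathcomp Require Import all_classical all_reals all_analysis.
Set Implicit Arguments.
Unset Strict Implicit.
Unset Printing Implicit Defensive.
Import Order.TTheory GRing.Theory Num.Theory.
Import numFieldNormedType.Exports.
Local Open Scope ring_scope.
Local Open Scope classical_set_scope.

(* The base field K is a parameter for technical reasons only: everything below
   is meant for K = C, that is R[i] with R : realType (the theorem is stated for
   this K). Then [differentiable] is complex (Frechet) differentiability, which
   on an open set is holomorphy. *)
Definition holomorphic_on (K : numFieldType) (V W : normedModType K)
  (A : set V) (f : V -> W) : Prop := forall z, A z -> differentiable f z.

(* Complex manifolds of pure dimension n, for K = C. The function [chart_at]
   selects, for each point p, a preferred chart around p; it is used below only
   to represent tangent vectors.
   [transition_diff_holomorphic] is a consequence of [transition_holomorphic]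
   (partial derivatives of holomorphic functions are holomorphic, by Cauchy's
   formula); it is recorded because the library has no Cauchy theory. *)
Record complexManifold (K : numFieldType) (n : nat) := ComplexManifold {
  carrier :> topologicalType ;
  carrier_hausdorff : hausdorff_space carrier ;
  carrier_second_countable : @second_countable carrier ;
  chart_index : Type ;
  chart_dom : chart_index -> set carrier ;
  chart : chart_index -> carrier -> 'rV[K]_n ;
  chart_inv : chart_index -> 'rV[K]_n -> carrier ;
  chart_dom_open : forall i, open (chart_dom i) ;
  chart_image_open : forall i, open (chart i @` chart_dom i) ;
  chartK : forall i, {in chart_dom i, cancel (chart i) (chart_inv i)} ;
  chart_continuous : forall i p, chart_dom i p -> {for p, continuous (chart i)} ;
  chart_inv_continuous : forall i p, chart_dom i p ->
    {for chart i p, continuous (chart_inv i)} ;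
  transition_holomorphic : forall i j,
    holomorphic_on (chart i @` (chart_dom i `&` chart_dom j))
      (chart j \o chart_inv i) ;
  transition_diff_holomorphic : forall i j v,
    holomorphic_on (chart i @` (chart_dom i `&` chart_dom j))
      (fun z => 'd (chart j \o chart_inv i) z v) ;
  chart_at : carrier -> chart_index ;
  chart_at_dom : forall p, chart_dom (chart_at p) p
}.

Section VectorFields.
Context {K : numFieldType} {n : nat} {M : complexManifold K n}.

(* The tangent space T_pM is K^n: a tangent vector at p is given by its
   components in the chart [chart_at p]. Hence a section of TM over an open
   set U is a function M -> K^n, of which only the values on U matter; sections
   over U are compared by [{in U, x =1 y}]. *)
Local Notation section := (M -> 'rV[K]_n).

Definition holomorphic_function (U : set M) (f : M -> K^o) : Prop :=
  forall i : chart_index M,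
    holomorphic_on (chart i @` (chart_dom i `&` U)) (f \o chart_inv i).

(* components of x in the chart i, as a function on the image of the chart *)
Definition components (i : chart_index M) (x : section) :
    'rV[K]_n -> 'rV[K]_n := fun z =>
  let p := chart_inv i z in
  'd (chart i \o chart_inv (chart_at p)) (chart (chart_at p) p) (x p).

Definition vector_field (U : set M) (x : section) : Prop :=
  forall i : chart_index M,
    holomorphic_on (chart i @` (chart_dom i `&` U)) (components i x).

(* the derivative x(f) of a function f along x *)
Definition derivation (x : section) (f : M -> K^o) : M -> K^o := fun p =>
  'd (f \o chart_inv (chart_at p)) (chart (chart_at p) p) (x p).

Definition lie_bracket (x y : section) : section := fun p =>
  let i := chart_at p in
  'd (components i y) (chart i p) (x p) - 'd (components i x) (chart i p) (y p).

Definition smul (f : M -> K^o) (x : section) : section :=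
  fun p => f p *: x p.

(* the vector field, defined on the domain of [chart_at p], which has constant
   components v in that chart *)
Definition constant_field (p : M) (v : 'rV[K]_n) : section := fun q =>
  'd (chart (chart_at q) \o chart_inv (chart_at p)) (chart (chart_at p) q) v.

(* Binary operations on the tangent sheaf of the open set W: a family indexed
   by the open subsets U of W, where op U only matters on vector fields on U. *)
Definition sheaf_operation (W : set M)
    (op : set M -> section -> section -> section) : Prop :=
  (forall U x y, open U -> U `<=` W -> vector_field U x -> vector_field U y ->
     vector_field U (op U x y)) /\
  (forall U V x y x' y', open U -> open V -> V `<=` U -> U `<=` W ->
     vector_field U x -> vector_field U y ->
     vector_field V x' -> vector_field V y' ->
     {in V, x' =1 x} -> {in V, y' =1 y} ->
     {in V, op V x' y' =1 op U x y}).

Definition left_linear (W : set M)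
    (op : set M -> section -> section -> section) : Prop :=
  forall U x y z f, open U -> U `<=` W ->
    vector_field U x -> vector_field U y -> vector_field U z ->
    holomorphic_function U f ->
    {in U, op U (x + y) z =1 op U x z + op U y z} /\
    {in U, op U (smul f x) z =1 smul f (op U x z)}.

Definition right_linear (W : set M)
    (op : set M -> section -> section -> section) : Prop :=
  forall U x y z f, open U -> U `<=` W ->
    vector_field U x -> vector_field U y -> vector_field U z ->
    holomorphic_function U f ->
    {in U, op U x (y + z) =1 op U x y + op U x z} /\
    {in U, op U x (smul f y) =1 smul f (op U x y)}.

Definition right_derivation (W : set M)
    (op : set M -> section -> section -> section) : Prop :=
  forall U x y z f, open U -> U `<=` W ->
    vector_field U x -> vector_field U y -> vector_field U z ->
    holomorphic_function U f ->
    {in U, op U x (y + z) =1 op U x y + op U x z} /\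
    {in U, op U x (smul f y) =1 smul (derivation x f) y + smul f (op U x y)}.

Definition is_multiplication W op :=
  [/\ sheaf_operation W op, left_linear W op & right_linear W op].

Definition is_connection W op :=
  [/\ sheaf_operation W op, left_linear W op & right_derivation W op].

End VectorFields.

(* The data common to Saito and almost Saito structures on an open set W of M:
   a connection, a multiplication with its unit field, and a further vector
   field: the field E of a Saito structure, resp. e of an almost Saito one. *)
Record tangentStructure (K : numFieldType) (n : nat) (M : complexManifold K n) :=
    TangentStructure {
  dom : set M ;
  nabla : set M -> (M -> 'rV[K]_n) -> (M -> 'rV[K]_n) -> M -> 'rV[K]_n ;
  mult : set M -> (M -> 'rV[K]_n) -> (M -> 'rV[K]_n) -> M -> 'rV[K]_n ;
  unit_field : M -> 'rV[K]_n ;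
  aux_field : M -> 'rV[K]_n
}.

Section Structures.
Context {K : numFieldType} {n : nat} {M : complexManifold K n}.
Local Notation section := (M -> 'rV[K]_n).
Implicit Types (S : tangentStructure M) (x y z : section).

Definition torsion_free S : Prop := forall U x y,
  open U -> U `<=` dom S -> vector_field U x -> vector_field U y ->
  {in U, nabla S U x y - nabla S U y x =1 lie_bracket x y}.

Definition flat S : Prop := forall U x y z, open U -> U `<=` dom S ->
  vector_field U x -> vector_field U y -> vector_field U z ->
  {in U, nabla S U x (nabla S U y z) - nabla S U y (nabla S U x z)
         - nabla S U (lie_bracket x y) z =1 0}.

Definition mult_associative S : Prop := forall U x y z,
  open U -> U `<=` dom S ->
  vector_field U x -> vector_field U y -> vector_field U z ->
  {in U, mult S U (mult S U x y) z =1 mult S U x (mult S U y z)}.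

Definition mult_commutative S : Prop := forall U x y,
  open U -> U `<=` dom S -> vector_field U x -> vector_field U y ->
  {in U, mult S U x y =1 mult S U y x}.

Definition mult_unital S : Prop := forall U x,
  open U -> U `<=` dom S -> vector_field U x ->
  {in U, mult S U (unit_field S) x =1 x}.

Definition potentiality S : Prop := forall U x y z,
  open U -> U `<=` dom S ->
  vector_field U x -> vector_field U y -> vector_field U z ->
  {in U, nabla S U x (mult S U y z) - mult S U y (nabla S U x z)
         - nabla S U y (mult S U x z) + mult S U x (nabla S U y z)
         =1 mult S U (lie_bracket x y) z}.

Record is_tangent_structure S : Prop := {
  dom_open : open (dom S) ;
  nabla_connection : is_connection (dom S) (nabla S) ;
  nabla_torsion_free : torsion_free S ;
  nabla_flat : flat S ;
  mult_multiplication : is_multiplication (dom S) (mult S) ;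
  mult_assoc : mult_associative S ;
  mult_comm : mult_commutative S ;
  unit_vector_field : vector_field (dom S) (unit_field S) ;
  mult_unit : mult_unital S ;
  aux_vector_field : vector_field (dom S) (aux_field S) ;
  nabla_mult_potentiality : potentiality S
}.

Record is_saito S (e := unit_field S) (E := aux_field S) : Prop := {
  saito_base : is_tangent_structure S ;
  saito_mult_degree : forall U x y, open U -> U `<=` dom S ->
    vector_field U x -> vector_field U y ->
    {in U, lie_bracket E (mult S U x y) - mult S U (lie_bracket E x) y
           - mult S U x (lie_bracket E y) =1 mult S U x y} ;
  saito_unit_flat : forall U x, open U -> U `<=` dom S -> vector_field U x ->
    {in U, nabla S U x e =1 0} ;
  saito_euler_affine : forall U x y, open U -> U `<=` dom S ->
    vector_field U x -> vector_field U y ->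
    {in U, nabla S U x (nabla S U y E) - nabla S U (nabla S U x y) E =1 0}
}.

Record is_almost_saito (r : K) S (E := unit_field S) (e := aux_field S) :
    Prop := {
  almost_saito_base : is_tangent_structure S ;
  almost_saito_nonzero : exists2 p, dom S p & e p != 0 ;
  almost_saito_mult_derivation : forall U x y, open U -> U `<=` dom S ->
    vector_field U x -> vector_field U y ->
    {in U, lie_bracket e (mult S U x y) - mult S U (lie_bracket e x) y
           - mult S U x (lie_bracket e y) + mult S U (mult S U e x) y =1 0} ;
  almost_saito_unit : forall U x, open U -> U `<=` dom S -> vector_field U x ->
    {in U, nabla S U x E =1 r *: x} ;
  almost_saito_hessian : forall U x y, open U -> U `<=` dom S ->
    vector_field U x -> vector_field U y ->
    {in U, nabla S U x (nabla S U y e) - nabla S U (nabla S U x y) e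
           + nabla S U (mult S U x y) e =1 0}
}.

(* The multiplication induced on T_pM by O-bilinearity: extend the two tangent
   vectors to vector fields near p, multiply, and evaluate at p. *)
Definition tangent_mult S (p : M) (v w : 'rV[K]_n) : 'rV[K]_n :=
  mult S (dom S `&` chart_dom (chart_at p))
    (constant_field p v) (constant_field p w) p.

(* the points where multiplication by the field E, resp. e, is invertible *)
Definition invertible_locus S : set M :=
  [set p | dom S p /\ bijective (tangent_mult S p (aux_field S p))].

(* The preimage of z under an operator P on the vector fields on U; it is the
   unique one on U when P is bijective on the vector fields on U, as is the
   multiplication by E (resp. e) if U lies in [invertible_locus]. *)
Definition operator_inv (U : set M) (P : section -> section) z : section :=
  xget (0 : section) [set w | vector_field U w /\ {in U, P w =1 z}].

Definition dual_mult S (U : set M) x y : section :=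
  operator_inv U (mult S U (aux_field S)) (mult S U x y).

(* In a dual structure the unit field and the other field are exchanged. *)
Definition dual_almost_saito (r : K) S : tangentStructure M :=
  {| dom := invertible_locus S ;
     nabla := fun U x y => nabla S U x y + r *: dual_mult S U x y
                           - nabla S U (dual_mult S U x y) (aux_field S) ;
     mult := dual_mult S ;
     unit_field := aux_field S ;
     aux_field := unit_field S |}.

Definition dual_saito S : tangentStructure M :=
  {| dom := invertible_locus S ;
     nabla := fun U x y =>
       nabla S U x y - nabla S U (dual_mult S U x y) (aux_field S) ;
     mult := dual_mult S ;
     unit_field := aux_field S ;
     aux_field := unit_field S |}.

Definition restrict_to (W : set M) S : tangentStructure M :=
  {| dom := W ; nabla := nabla S ; mult := mult S ;
     unit_field := unit_field S ; aux_field := aux_field S |}.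

Record same_structure S S' : Prop := {
  same_dom : dom S = dom S' ;
  same_nabla : forall U x y, open U -> U `<=` dom S ->
    vector_field U x -> vector_field U y ->
    {in U, nabla S U x y =1 nabla S' U x y} ;
  same_mult : forall U x y, open U -> U `<=` dom S ->
    vector_field U x -> vector_field U y ->
    {in U, mult S U x y =1 mult S' U x y} ;
  same_unit : {in dom S, unit_field S =1 unit_field S'} ;
  same_aux : {in dom S, aux_field S =1 aux_field S'}
}.

End Structures.

(* Main.v *)
Require Import Defs.
From mathcomp Require Import all_boot all_order all_algebra.
From mathcomp Require Import complex.
From mathcomp Require Import all_classical all_reals all_analysis.
Set Implicit Arguments.
Unset Strict Implicit.
Unset Printing Implicit Defensive.
Import Order.TTheory GRing.Theory Num.Theory.
Import numFieldNormedType.Exports.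
Local Open Scope ring_scope.
Local Open Scope complex_scope.
Local Open Scope classical_set_scope.

(** Both duals are made from one operation: divide the product [x * y] by the
multiplication by the auxiliary field [a] ([a = E] for a Saito structure,
[a = e] for an almost Saito one).  Write [u] for the unit field and
[x . y = a^-1 (x * y)] for the dual product, whose unit is [a].  In the dual
structure the auxiliary field is [u], and [u . (x * y) = a^-1 (x * y) = x . y]:
for the dual product, multiplication by [u] is the inverse of multiplication by
[a].  So it is invertible wherever the first one is
([invertible_locus_dual]), and dividing [x . y] by it gives back [x * y]
([dual_mult_dual]).

For the connections the key is [(x * y) . u = x . y], that is,
[dual_mult_dual_unit].  In the first case, with [a = E] and [u = e], dualizing
adds [r (x . y) - D_(x . y) E] to [D_x y], and dualizing again subtracts
[D_(x * y) e + r ((x * y) . e) - D_((x * y) . e) E].  Since [D e = 0], the two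
cancel.  In the second case, with [a = e] and [u = E], the first step subtracts
[D_(x . y) e] and the second adds
[r (x * y) - (D_(x * y) E - D_((x * y) . E) e)]; these cancel because
[D_z E = r z].

What needs work is that [dual_mult] behaves as this says: it is defined by
choosing a vector field [w] with [a * w = x * y] on [U], and such a holomorphic
[w] must exist ([aux_division]) and be unique ([aux_cancel]).  The product of
two fields at a point depends only on their values there ([mult_tangent]),
because an O-linear operation can be computed in the coordinate frame of a
chart.  So the multiplication by [a] is, in a chart, a matrix with holomorphic
entries ([aux_matrixP]).  Where it is invertible its determinant does not
vanish, which is an open condition, and by Cramer's rule the solution of a
linear system with holomorphic coefficients is holomorphic
([differentiable_linear_system]). *)

(** * Differentiability of solutions of linear systems *)

Section Calculus.
Context {K : numFieldType} {V : normedModType K}.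

Lemma is_diff_near0 (W : normedModType K) (h : V -> W) (x : V) :
  (\forall z \near x, h z = 0) -> is_diff x h 0.
Proof.
move=> h0.
have hE : h \o shift x = cst (h x) + \0 +o_ 0 id.
  apply/eqaddoP => _ /posnumP[e].
  have : \forall z \near 0, h (z + x) = 0.
    by move: h0; rewrite [\forall z \near x, _](near_shift 0) subr0.
  apply: filterS => z hz.
  by rewrite /= !fctE /= hz (nbhs_singleton h0) /= addr0 subr0 normr0 mulr_ge0.
have c0 : continuous (\0 : V -> W) by move=> ?; exact: cst_continuous.
have dh : 'd h x = \0 :> (V -> W) by exact: (diff_unique c0 hE).
by split => //; apply/diff_locallyP; rewrite dh.
Qed.

(** Differentiability and the differential are local: the difference of two
functions which agree near [x] is a little-o of everything. *)
Lemma is_diff_near_eq (W : normedModType K) (f g df : V -> W) (x : V) :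
  (\forall z \near x, f z = g z) -> is_diff x f df -> is_diff x g df.
Proof.
move=> fg fdf.
have h0 : is_diff x (g - f) 0.
  by apply: is_diff_near0; apply: filterS fg => z fgz; rewrite !fctE fgz subrr.
have -> : g = f + (g - f) by rewrite addrC subrK.
by rewrite -[df]addr0; exact: is_diffD.
Qed.

Lemma near_eq_differentiable (W : normedModType K) (f g : V -> W) (x : V) :
  (\forall z \near x, f z = g z) -> differentiable f x -> differentiable g x.
Proof. by move=> fg /differentiableP /(is_diff_near_eq fg) []. Qed.

Lemma differentiable_sumr (W : normedModType K) (I : Type) (r : seq I)
    (P : pred I) (F : I -> V -> W) (x : V) :
  (forall i, P i -> differentiable (F i) x) ->
  differentiable (fun z => \sum_(i <- r | P i) F i z) x.
Proof.
move=> dF; elim: r => [|i r IHr].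
  by under eq_fun do rewrite big_nil; exact: differentiable_cst.
under eq_fun do rewrite big_cons.
case Pi: (P i) => //.
by apply: differentiableD => //; exact: dF.
Qed.

Lemma differentiable_prodr (I : Type) (r : seq I) (F : I -> V -> K) (x : V) :
  (forall i, differentiable (F i) x) ->
  differentiable (fun z => \prod_(i <- r) F i z) x.
Proof.
move=> dF; elim: r => [|i r IHr].
  by under eq_fun do rewrite big_nil; exact: differentiable_cst.
under eq_fun do rewrite big_cons.
exact: differentiableM.
Qed.

Lemma differentiable_row (n : nat) (f : V -> 'rV[K]_n) (x : V) :
  (forall j, differentiable (fun z => f z 0 j) x) -> differentiable f x.
Proof.
move=> df.
have -> : f = fun z => \sum_(j < n) f z 0 j *: delta_mx 0 j.
  by apply/funext => z; exact: row_sum_delta.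
by apply: differentiable_sumr => j _; exact: differentiableZl.
Qed.

Lemma differentiable_entry (m n : nat) (f : V -> 'M[K]_(m, n)) (x : V) i j :
  differentiable f x -> differentiable (fun z => f z i j) x.
Proof.
move=> df.
by apply: (differentiable_comp df (@differentiable_coord _ _ _ (f x) i j)).
Qed.

Lemma differentiable_det (n : nat) (A : V -> 'M[K]_n) (x : V) :
  (forall i j, differentiable (fun z => A z i j) x) ->
  differentiable (fun z => \det (A z)) x.
Proof.
move=> dA; apply: differentiable_sumr => s _.
apply: differentiableM; first exact: differentiable_cst.
exact: differentiable_prodr.
Qed.

Lemma differentiable_adj (n : nat) (A : V -> 'M[K]_n) (x : V) i j :
  (forall i j, differentiable (fun z => A z i j) x) ->
  differentiable (fun z => (\adj (A z)) i j) x.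
Proof.
move=> dA; under eq_fun do rewrite mxE.
apply: differentiableM; first exact: differentiable_cst.
by apply: differentiable_det => k l; under eq_fun do rewrite !mxE.
Qed.

Lemma near_det_neq0 (n : nat) (A : V -> 'M[K]_n) (x : V) :
  (forall i j, differentiable (fun z => A z i j) x) -> \det (A x) != 0 ->
  \forall z \near x, \det (A z) != 0.
Proof.
move=> dA detA.
have := differentiable_continuous (differentiable_det dA).
by move=> /cvgr_neq0; apply.
Qed.

(** Cramer's rule: near [x], [c z] is the inverse of the determinant times
[b z *m \adj (A z)]. *)
Lemma differentiable_linear_system (n : nat) (A : V -> 'M[K]_n)
    (b c : V -> 'rV[K]_n) (x : V) :
  (forall i j, differentiable (fun z => A z i j) x) -> differentiable b x ->
  \det (A x) != 0 -> (\forall z \near x, c z *m A z = b z) ->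
  differentiable c x.
Proof.
move=> dA db detA cA.
apply: (@near_eq_differentiable _
  (fun z => \row_j ((\det (A z))^-1 * \sum_k b z 0 k * (\adj (A z)) k j))).
  have := near_det_neq0 dA detA; apply: filterS2 cA => z cAz detAz.
  apply/rowP => j; rewrite mxE.
  have -> : \sum_k b z 0 k * \adj (A z) k j = (b z *m \adj (A z)) 0 j.
    by rewrite mxE.
  by rewrite -cAz -mulmxA mul_mx_adj mul_mx_scalar mxE mulKf.
apply: differentiable_row => j; under eq_fun do rewrite mxE.
apply: differentiableM.
  by apply: differentiableV => //; exact: differentiable_det.
apply: differentiable_sumr => k _; apply: differentiableM.
  exact: differentiable_entry.
exact: differentiable_adj.
Qed.

End Calculus.

(** * Tangent vectors in charts *)

Section Tangent.
Context {K : numFieldType} {n : nat} {M : complexManifold K n}.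
Local Notation section := (M -> 'rV[K]_n).
Implicit Types (i j k : chart_index M) (p q : M) (v w : 'rV[K]_n)
  (U : set M) (x y : section).

Lemma chart_inK i p : chart_dom i p -> chart_inv i (chart i p) = p.
Proof. by move=> ip; apply: chartK; exact: mem_set. Qed.

(** Transfers a property valid near [p] to the points of the chart image near
[chart i p]; this holds since the image is open and [chart_inv i] is
continuous. *)
Lemma near_chart i p (P : set M) : chart_dom i p -> nbhs p P ->
  \forall z \near chart i p, exists q, [/\ chart_dom i q, P q & z = chart i q].
Proof.
move=> ip Pp.
have im : nbhs (chart i p) (chart i @` chart_dom i).
  by apply: open_nbhs_nbhs; split; [exact: chart_image_open|exists p].
have inv : nbhs (chart i p) (chart_inv i @^-1` P).
  by apply: (chart_inv_continuous ip); rewrite chart_inK.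
apply: filterS2 im inv => z [q iq <-] /=; rewrite chart_inK // => Pq.
by exists q.
Qed.

Definition transition i j p : 'rV[K]_n -> 'rV[K]_n :=
  'd (chart j \o chart_inv i) (chart i p).

Lemma transitionD i j p v w :
  transition i j p (v + w) = transition i j p v + transition i j p w.
Proof. exact: raddfD. Qed.

Lemma transitionZ i j p (a : K) v :
  transition i j p (a *: v) = a *: transition i j p v.
Proof. exact: linearZ. Qed.

Lemma transition0 i j p : transition i j p 0 = 0.
Proof. exact: raddf0. Qed.

Lemma transition_sum i j p (I : Type) (r : seq I) (c : I -> K)
    (v : I -> 'rV[K]_n) :
  transition i j p (\sum_(k <- r) c k *: v k) =
    \sum_(k <- r) c k *: transition i j p (v k).
Proof.
elim: r => [|k r IHr]; first by rewrite !big_nil transition0.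
by rewrite !big_cons transitionD transitionZ IHr.
Qed.

Lemma chart_change_differentiable i j p : chart_dom i p -> chart_dom j p ->
  differentiable (chart j \o chart_inv i) (chart i p).
Proof. by move=> ip jp; apply: transition_holomorphic; exists p. Qed.

(** The cocycle rule is the chain rule, because near [chart i p] the change from
[i] to [k] is the change from [i] to [j] followed by the one from [j] to [k]. *)
Lemma transition_comp i j k p v :
  chart_dom i p -> chart_dom j p -> chart_dom k p ->
  transition j k p (transition i j p v) = transition i k p v.
Proof.
move=> ip jp kp.
have dij := differentiableP (chart_change_differentiable ip jp).
have djk : is_diff ((chart j \o chart_inv i) (chart i p))
    (chart k \o chart_inv j) (transition j k p).
  have -> : (chart j \o chart_inv i) (chart i p) = chart j p.
    by rewrite /= chart_inK.
  exact/differentiableP/chart_change_differentiable.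
have near_eq : \forall z \near chart i p,
    ((chart k \o chart_inv j) \o (chart j \o chart_inv i)) z =
    (chart k \o chart_inv i) z.
  apply: filterS (near_chart ip (open_nbhs_nbhs (conj (chart_dom_open j) jp))).
  by move=> _ [q [iq jq ->]]; rewrite /= !chart_inK.
have [_ compE] := is_diff_near_eq near_eq (is_diff_comp dij djk).
exact/esym/(congr1 (fun g : 'rV[K]_n -> 'rV[K]_n => g v) compE).
Qed.

Lemma transition_id i p v : chart_dom i p -> transition i i p v = v.
Proof.
move=> ip.
have near_id : \forall z \near chart i p, id z = (chart i \o chart_inv i) z.
  apply: filterS (near_chart ip (@filterT _ (nbhs p) _)).
  by move=> _ [q [iq _ ->]]; rewrite /= chart_inK.
have [_ idE] := is_diff_near_eq near_id (is_diff_id (chart i p)).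
exact: (congr1 (fun g : 'rV[K]_n -> 'rV[K]_n => g v) idE).
Qed.

Lemma transitionK i j p : chart_dom i p -> chart_dom j p ->
  cancel (transition i j p) (transition j i p).
Proof. by move=> ip jp v; rewrite transition_comp // transition_id. Qed.

Lemma components_chart i p x : chart_dom i p ->
  components i x (chart i p) = transition (chart_at p) i p (x p).
Proof. by move=> ip; rewrite /components chart_inK. Qed.

Lemma components_eq i p x y : chart_dom i p -> x p = y p ->
  components i x (chart i p) = components i y (chart i p).
Proof. by move=> ip xy; rewrite !components_chart // xy. Qed.

Lemma componentsD i x y z :
  components i (x + y) z = components i x z + components i y z.
Proof. exact: raddfD. Qed.

Lemma components_smul i (f : M -> K^o) x z :
  components i (smul f x) z = f (chart_inv i z) *: components i x z.
Proof. exact: linearZ. Qed.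

Lemma vector_fieldP U x : vector_field U x <->
  forall i p, chart_dom i p -> U p ->
    differentiable (components i x) (chart i p).
Proof.
split=> [xU i p ip Up|xU i _ [p [ip Up] <-]]; last exact: xU.
by apply: xU; exists p.
Qed.

Lemma vector_field_sub U U' x : U' `<=` U -> vector_field U x ->
  vector_field U' x.
Proof.
by move=> U'U /vector_fieldP xU; apply/vector_fieldP => i p ip /U'U; exact: xU.
Qed.

Lemma vector_fieldD U x y : vector_field U x -> vector_field U y ->
  vector_field U (x + y).
Proof.
move=> xU yU i z zU.
have -> : components i (x + y) = components i x + components i y.
  by apply/funext => t; exact: componentsD.
by apply: differentiableD; [exact: xU|exact: yU].
Qed.

Lemma vector_field_smul U (f : M -> K^o) x : holomorphic_function U f ->
  vector_field U x -> vector_field U (smul f x).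
Proof.
move=> fU xU i z zU.
have -> : components i (smul f x) =
    fun t => \row_j (f (chart_inv i t) * components i x t 0 j).
  by apply/funext => t; apply/rowP => j; rewrite components_smul !mxE.
apply: differentiable_row => j; under eq_fun do rewrite mxE.
apply: differentiableM; first exact: fU.
apply: differentiable_entry; exact: xU.
Qed.

Lemma holomorphic_cst U (a : K^o) : holomorphic_function U (cst a).
Proof. by move=> i z _; exact: differentiable_cst. Qed.

(** [constant_field] for an arbitrary chart; [frame i (delta_mx 0 j)] is the
[j]-th coordinate vector field of the chart [i]. *)
Definition frame i v : section := fun p => transition i (chart_at p) p v.

Lemma constant_fieldE p v : constant_field p v = frame (chart_at p) v.
Proof. by []. Qed.

Lemma constant_field_id p v : constant_field p v p = v.
Proof. exact/transition_id/chart_at_dom. Qed.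

Lemma components_frame i j p v : chart_dom i p -> chart_dom j p ->
  components j (frame i v) (chart j p) = transition i j p v.
Proof.
move=> ip jp; rewrite components_chart // transition_comp //.
exact: chart_at_dom.
Qed.

(** In another chart [j], the components at [q] are the differential of the
change of charts at [chart i q], applied to [v]; it depends holomorphically on
[q] by [transition_diff_holomorphic]. *)
Lemma vector_field_frame i v : vector_field (chart_dom i) (frame i v).
Proof.
apply/vector_fieldP => j p jp ip.
apply: (@near_eq_differentiable _ _ _
  ((fun z => 'd (chart j \o chart_inv i) z v) \o (chart i \o chart_inv j))).
  apply: filterS (near_chart jp (open_nbhs_nbhs (conj (chart_dom_open i) ip))).
  move=> _ [q [jq iq ->]].
  by rewrite (components_frame v iq jq) /comp (chart_inK jq).
apply: differentiable_comp; first exact: chart_change_differentiable.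
rewrite /= chart_inK //.
by apply: transition_diff_holomorphic; exists p.
Qed.

Definition coordinate i x (j : 'I_n) : M -> K^o :=
  fun p => components i x (chart i p) 0 j.

Lemma holomorphic_coordinate i U x (j : 'I_n) : U `<=` chart_dom i ->
  vector_field U x -> holomorphic_function U (coordinate i x j).
Proof.
move=> Ui /vector_fieldP xU k _ [p [kp Up] <-].
apply: differentiable_entry.
apply: (@differentiable_comp _ _ _ _ (chart i \o chart_inv k) (components i x)).
  exact/chart_change_differentiable/Ui.
by rewrite /= chart_inK //; apply: xU => //; exact: Ui.
Qed.

Lemma frame_decomposition i x p : chart_dom i p ->
  x p = (\sum_(j < n) smul (coordinate i x j) (frame i (delta_mx 0 j))) p.
Proof.
move=> ip; rewrite fct_sumE.
transitivity (frame i (components i x (chart i p)) p).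
  by rewrite components_chart // /frame transitionK //; exact: chart_at_dom.
by rewrite [components i x _]row_sum_delta /frame transition_sum.
Qed.

End Tangent.

(** * Linear operations act pointwise *)

Section PointwiseOperations.
Context {K : numFieldType} {n : nat} {M : complexManifold K n}.
Local Notation section := (M -> 'rV[K]_n).
Implicit Types (i : chart_index M) (p q : M) (v w : 'rV[K]_n)
  (U W : set M) (x y : section) (op : set M -> section -> section -> section).

Lemma sheaf_operation_at W op U U' x y x' y' p : sheaf_operation W op ->
  open U -> open U' -> U' `<=` U -> U `<=` W ->
  vector_field U x -> vector_field U y ->
  vector_field U' x' -> vector_field U' y' ->
  {in U', x' =1 x} -> {in U', y' =1 y} -> U' p -> op U' x' y' p = op U x y p.
Proof.
move=> [_ rst] oU oU' UU' UW xU yU xU' yU' xx' yy' Up.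
by apply: (rst U U') => //; exact: mem_set.
Qed.

Lemma eq_op_left W op U x x' y : sheaf_operation W op ->
  open U -> U `<=` W ->
  vector_field U x -> vector_field U x' -> vector_field U y ->
  {in U, x =1 x'} -> {in U, op U x y =1 op U x' y}.
Proof. by move=> [_ rst] *; apply: (rst U U). Qed.

Lemma left_linear_sum W op U y p (I : Type) (r : seq I) (f : I -> M -> K^o)
    (F : I -> section) :
  left_linear W op -> open U -> U `<=` W -> U p -> vector_field U y ->
  (forall i : I, holomorphic_function U (f i)) ->
  (forall i : I, vector_field U (F i)) ->
  vector_field U (\sum_(i <- r) smul (f i) (F i)) /\
  op U (\sum_(i <- r) smul (f i) (F i)) y p =
    \sum_(i <- r) f i p *: op U (F i) y p.
Proof.
move=> lin oU UW Up yU fU FU.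
have /mem_set Up' := Up.
elim: r => [|i r [sumU IHr]].
  rewrite !big_nil.
  have z0 : smul (cst 0) y = 0 by apply/funext => q; exact: scale0r.
  split; first by rewrite -z0; exact/vector_field_smul/yU/holomorphic_cst.
  have hc : holomorphic_function U (cst (0 : K^o)) by exact: holomorphic_cst.
  have [_ /(_ p Up') opZ] := lin U y y y _ oU UW yU yU yU hc.
  by rewrite -z0 opZ; exact: scale0r.
rewrite !big_cons.
have hU : vector_field U (smul (f i) (F i)) by exact: vector_field_smul.
split; first exact: vector_fieldD.
have [/(_ p Up') -> _] := lin U _ _ y _ oU UW hU sumU yU (fU i).
have [_ /(_ p Up') opZ] := lin U _ _ y _ oU UW (FU i) sumU yU (fU i).
by rewrite -IHr; congr (_ + _).
Qed.

(** On the chart domain around [p] one has [x = \sum_j f_j F_j], with [F_j] the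
coordinate fields; hence [op x y = \sum_j f_j (op F_j y)], and at [p] this only
involves [x] through the numbers [f_j p]. *)
Lemma left_linear_pointwise W op U x x' y p :
  sheaf_operation W op -> left_linear W op -> open U -> U `<=` W ->
  vector_field U x -> vector_field U x' -> vector_field U y -> U p ->
  x p = x' p -> op U x y p = op U x' y p.
Proof.
move=> sh lin oU UW xU xU' yU Up xp.
pose i := chart_at p; pose V := U `&` chart_dom i.
have ip : chart_dom i p by exact: chart_at_dom.
have oV : open V by exact: openI (chart_dom_open i).
have VU : V `<=` U by exact: subIsetl.
have Vi : V `<=` chart_dom i by exact: subIsetr.
have VW : V `<=` W by exact: subset_trans UW.
have yV := vector_field_sub VU yU.
have Vp : V p by [].
suff opE x0 : vector_field U x0 -> op U x0 y p =
    \sum_(j < n) coordinate i x0 j p *: op V (frame i (delta_mx 0 j)) y p.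
  rewrite !opE //; apply: eq_bigr => j _.
  by rewrite /coordinate (components_eq ip xp).
move=> xU0.
have [sumV <-] := left_linear_sum (index_enum 'I_n) lin oV VW Vp yV
  (fun j => holomorphic_coordinate j Vi (vector_field_sub VU xU0))
  (fun j => vector_field_sub Vi (vector_field_frame (delta_mx 0 j))).
symmetry; apply: (sheaf_operation_at sh) => // q /set_mem [_ iq].
exact/esym/frame_decomposition.
Qed.

Lemma sheaf_operation_flip W op : sheaf_operation W op ->
  sheaf_operation W (fun U x y => op U y x).
Proof.
move=> [vf rst]; split=> [U x y *|U U' x y x' y' *]; first exact: vf.
exact: (rst U U').
Qed.

Lemma right_linear_pointwise W op U x y y' p :
  sheaf_operation W op -> right_linear W op -> open U -> U `<=` W ->
  vector_field U x -> vector_field U y -> vector_field U y' -> U p ->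
  y p = y' p -> op U x y p = op U x y' p.
Proof.
move=> sh lin oU UW xU yU yU' Up yy'.
apply: (@left_linear_pointwise W (fun U x y => op U y x)) => //.
  exact: sheaf_operation_flip.
by move=> U0 y0 z0 x0 f oU0 U0W yU0 zU0 xU0; exact: lin.
Qed.

End PointwiseOperations.

(** * Multiplication by the auxiliary field *)

Section TangentMultiplication.
Context {K : numFieldType} {n : nat} {M : complexManifold K n}.
Local Notation section := (M -> 'rV[K]_n).
Implicit Types (i : chart_index M) (p q : M) (u v w : 'rV[K]_n)
  (U : set M) (x y : section).
Variable S : tangentStructure M.
Hypothesis HS : is_tangent_structure S.
Local Notation a := (aux_field S).

Let shS : sheaf_operation (dom S) (mult S).
Proof. by have [] := mult_multiplication HS. Qed.
Let linS : left_linear (dom S) (mult S).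
Proof. by have [] := mult_multiplication HS. Qed.

Lemma vector_field_mult U x y : open U -> U `<=` dom S ->
  vector_field U x -> vector_field U y -> vector_field U (mult S U x y).
Proof. by case: shS => + _; apply. Qed.

Definition chart_nbhd p := dom S `&` chart_dom (chart_at p).

Lemma chart_nbhd_open p : open (chart_nbhd p).
Proof. exact: openI (dom_open HS) (chart_dom_open _). Qed.

Lemma chart_nbhd_dom p : chart_nbhd p `<=` dom S.
Proof. exact: subIsetl. Qed.

Lemma chart_nbhd_center p : dom S p -> chart_nbhd p p.
Proof. by move=> Sp; split => //; exact: chart_at_dom. Qed.

Lemma vector_field_constant p v :
  vector_field (chart_nbhd p) (constant_field p v).
Proof. exact: vector_field_sub (@subIsetr _ _ _) (vector_field_frame _). Qed.

Hint Resolve chart_nbhd_open chart_nbhd_dom vector_field_constant : core.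

Lemma mult_tangent U x y p : open U -> U `<=` dom S ->
  vector_field U x -> vector_field U y -> U p ->
  mult S U x y p = tangent_mult S p (x p) (y p).
Proof.
(* Both sides are computed on the common part of [U] and [chart_nbhd p]. *)
move=> oU UM xU yU Up; set V := U `&` chart_dom (chart_at p).
have oV : open V by exact: openI (chart_dom_open _).
have VU : V `<=` U by exact: subIsetl.
have VN : V `<=` chart_nbhd p by move=> q [/UM].
have VM : V `<=` dom S by exact: subset_trans UM.
have Vp : V p by split => //; exact: chart_at_dom.
have cV v := vector_field_sub VN (vector_field_constant v).
have xV := vector_field_sub VU xU; have yV := vector_field_sub VU yU.
transitivity (mult S V x y p).
  by symmetry; apply: (sheaf_operation_at shS).
transitivity (mult S V (constant_field p (x p)) (constant_field p (y p)) p).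
  rewrite (left_linear_pointwise shS linS oV VM xV (cV (x p)) yV Vp).
    have [_ _ linr] := mult_multiplication HS.
    by rewrite (right_linear_pointwise shS linr oV VM _ yV (cV (y p)) Vp) //
      constant_field_id.
  by rewrite constant_field_id.
by apply: (sheaf_operation_at (U := chart_nbhd p) shS).
Qed.

Lemma tangent_multC p v w : dom S p ->
  tangent_mult S p v w = tangent_mult S p w v.
Proof.
move=> /chart_nbhd_center/mem_set Np.
by apply: (mult_comm HS) Np.
Qed.

Lemma tangent_multP p (c : K) u v w : dom S p ->
  tangent_mult S p u (c *: v + w) =
    c *: tangent_mult S p u v + tangent_mult S p u w.
Proof.
move=> Sp; rewrite ![tangent_mult S p u _]tangent_multC //.
have Np := mem_set (chart_nbhd_center Sp).
have cN v' := @vector_field_constant p v'.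
have cE : constant_field p (c *: v + w) =
    smul (cst c) (constant_field p v) + constant_field p w.
  by apply/funext => q; rewrite !constant_fieldE /frame transitionD transitionZ.
have hc : holomorphic_function (chart_nbhd p) (cst (c : K^o)).
  exact: holomorphic_cst.
have scN := vector_field_smul hc (cN v).
rewrite /tangent_mult cE.
have [/(_ p Np) -> _] :=
  linS (@chart_nbhd_open p) (@chart_nbhd_dom p) scN (cN w) (cN u) hc.
have [_ /(_ p Np) opZ] :=
  linS (@chart_nbhd_open p) (@chart_nbhd_dom p) (cN v) (cN w) (cN u) hc.
by congr (_ + _).
Qed.

Lemma tangent_mult1 p v : dom S p -> tangent_mult S p (unit_field S p) v = v.
Proof.
move=> Sp; have Np := chart_nbhd_center Sp.
have cN v' := @vector_field_constant p v'.
have uN := vector_field_sub (@chart_nbhd_dom p) (unit_vector_field HS).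
have := mult_unit HS (@chart_nbhd_open p) (@chart_nbhd_dom p) (cN v)
  (mem_set Np).
by rewrite mult_tangent // constant_field_id.
Qed.

(** The matrix of the multiplication by the auxiliary field in the coordinate
frame; components are row vectors, so that it acts on them from the right. *)
Definition aux_matrix i (z : 'rV[K]_n) : 'M[K]_n := \matrix_(j < n)
  components i (mult S (dom S `&` chart_dom i) a (frame i (delta_mx 0 j))) z.

Lemma aux_matrix_differentiable i p (j k : 'I_n) : dom S p -> chart_dom i p ->
  differentiable (fun z => aux_matrix i z j k) (chart i p).
Proof.
move=> Sp ip; under eq_fun do rewrite mxE.
apply: differentiable_entry.
have oN : open (dom S `&` chart_dom i).
  exact: openI (dom_open HS) (chart_dom_open _).
have NS : dom S `&` chart_dom i `<=` dom S by exact: subIsetl.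
have vf := vector_field_mult oN NS
  (vector_field_sub NS (aux_vector_field HS))
  (vector_field_sub (@subIsetr _ _ _) (vector_field_frame (delta_mx 0 j))).
by move/vector_fieldP : vf; apply.
Qed.

Lemma tangent_mult_sum p u (I : Type) (r : seq I) (c : I -> K)
    (v : I -> 'rV[K]_n) : dom S p ->
  tangent_mult S p u (\sum_(j <- r) c j *: v j) =
    \sum_(j <- r) c j *: tangent_mult S p u (v j).
Proof.
move=> Sp; elim: r => [|j r IHr].
  2: by rewrite !big_cons tangent_multP // IHr.
rewrite !big_nil.
by have := tangent_multP (-1) u 0 0 Sp; rewrite scaler0 addr0 scaleN1r addNr.
Qed.

Lemma aux_matrixP i p v : dom S p -> chart_dom i p ->
  transition (chart_at p) i p (tangent_mult S p (a p) v) =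
  transition (chart_at p) i p v *m aux_matrix i (chart i p).
Proof.
move=> Sp ip; have pp := chart_at_dom p.
have oN : open (dom S `&` chart_dom i).
  exact: openI (dom_open HS) (chart_dom_open _).
have NS : dom S `&` chart_dom i `<=` dom S by exact: subIsetl.
have aN := vector_field_sub NS (aux_vector_field HS).
set c := transition _ _ _ v.
have -> : v = transition i (chart_at p) p c by rewrite transitionK.
rewrite [in LHS](row_sum_delta c) transition_sum.
rewrite tangent_mult_sum // transition_sum mulmx_sum_row; apply: eq_bigr => j _.
rewrite rowK components_chart // mult_tangent //.
exact: vector_field_sub (@subIsetr _ _ _) (vector_field_frame _).
Qed.

Lemma aux_bijective_det i p : dom S p -> chart_dom i p ->
  bijective (tangent_mult S p (a p)) <-> \det (aux_matrix i (chart i p)) != 0.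
Proof.
move=> Sp ip; have pp := chart_at_dom p.
have AP v := aux_matrixP v Sp ip.
split=> [/bij_inj injA|detA].
  apply/det0P => -[c c0 cA].
  move/eqP: c0; apply.
  rewrite -[c](transitionK ip pp) -[RHS](transition0 (chart_at p) i p).
  congr transition; apply: injA.
  apply: (can_inj (transitionK pp ip)).
  by rewrite !AP transitionK // cA transition0 mul0mx.
have uA : aux_matrix i (chart i p) \in unitmx by rewrite unitmxE unitfE.
exists (fun w => transition i (chart_at p) p
  (transition (chart_at p) i p w *m invmx (aux_matrix i (chart i p)))) => v.
  by rewrite AP mulmxK // transitionK.
by apply: (can_inj (transitionK pp ip)); rewrite AP transitionK // mulmxKV.
Qed.

(** Near a point of the locus, the determinant of the multiplication by the
auxiliary field is a continuous function in a single chart. *)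
Lemma invertible_locus_open : open (invertible_locus S).
Proof.
rewrite openE => p [Sp bij].
have pp := chart_at_dom p.
have detA := (aux_bijective_det Sp pp).1 bij.
have near_det : \forall z \near chart (chart_at p) p,
    \det (aux_matrix (chart_at p) z) != 0.
  by apply: near_det_neq0 => // j k; exact: aux_matrix_differentiable.
have nS := open_nbhs_nbhs (conj (chart_nbhd_open p) (chart_nbhd_center Sp)).
have nd := chart_continuous pp near_det.
apply: filterS2 nS nd => q [Sq iq] detq; split => //.
exact/(aux_bijective_det Sq iq).
Qed.

Lemma invertible_locus_dom : invertible_locus S `<=` dom S.
Proof. by move=> p []. Qed.

Hint Resolve invertible_locus_open invertible_locus_dom : core.

Lemma aux_cancel U x y : open U -> U `<=` invertible_locus S ->
  vector_field U x -> vector_field U y ->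
  {in U, mult S U a x =1 mult S U a y} -> {in U, x =1 y}.
Proof.
move=> oU UW xU yU xy p pU; have Up := set_mem pU; have [Sp bij] := UW p Up.
have US : U `<=` dom S by exact: subset_trans UW _.
have aU := vector_field_sub US (aux_vector_field HS).
apply: (bij_inj bij).
by have := xy p pU; rewrite !mult_tangent.
Qed.

(** The pointwise quotient is holomorphic because in each chart its components
solve a linear system with holomorphic coefficients. *)
Lemma aux_division U x : open U -> U `<=` invertible_locus S ->
  vector_field U x ->
  exists w : section, vector_field U w /\ {in U, mult S U a w =1 x}.
Proof.
move=> oU UW xU.
have US : U `<=` dom S by exact: subset_trans UW _.
have aU := vector_field_sub US (aux_vector_field HS).
pose w p := xget 0 [set v | tangent_mult S p (a p) v = x p].
have wP p : U p -> tangent_mult S p (a p) (w p) = x p.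
  move=> /UW [_ [g _ gK]]; rewrite /w; case: xgetP => [v _ //|].
  by move=> /(_ (g (x p))) /=; rewrite gK.
have wU : vector_field U w.
  apply/vector_fieldP => i p ip Up; have [Sp bij] := UW p Up.
  apply: (@differentiable_linear_system _ _ _ (aux_matrix i) (components i x)).
  - by move=> j k; exact: aux_matrix_differentiable.
  - by move/vector_fieldP : xU; apply.
  - exact/aux_bijective_det.
  apply: filterS (near_chart ip (open_nbhs_nbhs (conj oU Up))).
  move=> _ [q [iq Uq ->]]; rewrite !components_chart // -aux_matrixP ?wP //.
  exact: US.
exists w; split => // p pU.
by rewrite mult_tangent //; [exact/wP/set_mem|exact: set_mem].
Qed.

Lemma operator_invP U x : open U -> U `<=` invertible_locus S ->
  vector_field U x ->
  vector_field U (operator_inv U (mult S U a) x) /\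
  {in U, mult S U a (operator_inv U (mult S U a) x) =1 x}.
Proof.
move=> oU UW xU; rewrite /operator_inv; case: xgetP => [w _ //|noinv].
by have [w /noinv] := aux_division oU UW xU.
Qed.

Lemma dual_multP U x y : open U -> U `<=` invertible_locus S ->
  vector_field U x -> vector_field U y ->
  vector_field U (dual_mult S U x y) /\
  {in U, mult S U a (dual_mult S U x y) =1 mult S U x y}.
Proof.
move=> oU UW xU yU; apply: operator_invP => //.
by apply: vector_field_mult => //; exact: subset_trans UW _.
Qed.

End TangentMultiplication.

(** * The dual of a dual structure *)

Section DualOfDual.
Context {K : numFieldType} {n : nat} {M : complexManifold K n}.
Local Notation section := (M -> 'rV[K]_n).
Implicit Types (p q : M) (u v w : 'rV[K]_n) (U : set M) (x y z : section).

(* Of the dual structure [D] only the multiplication, the domain and the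
   auxiliary field are constrained, so that it may be the dual Saito or the dual
   almost Saito structure. *)
Variables S D : tangentStructure M.
Hypothesis HS : is_tangent_structure S.
Local Notation W := (invertible_locus S).
Hypotheses (domD : dom D = W) (multD : mult D = dual_mult S)
  (auxD : aux_field D = unit_field S).

Lemma eq_dual_mult U x y x' y' : open U -> U `<=` W ->
  vector_field U x -> vector_field U y ->
  vector_field U x' -> vector_field U y' ->
  {in U, mult S U x y =1 mult S U x' y'} ->
  {in U, dual_mult S U x y =1 dual_mult S U x' y'}.
Proof.
move=> oU UW xU yU xU' yU' xy; have [dU dxy] := dual_multP HS oU UW xU yU.
have [dU' dxy'] := dual_multP HS oU UW xU' yU'.
by apply: (aux_cancel HS oU UW dU dU') => p pU; rewrite dxy // dxy' // xy.
Qed.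

Lemma unit_vector_field_sub U : U `<=` W -> vector_field U (unit_field S).
Proof.
move=> UW; apply: vector_field_sub (unit_vector_field HS) => p /UW.
exact: invertible_locus_dom.
Qed.

Lemma vector_field_mult_sub U x y : open U -> U `<=` W ->
  vector_field U x -> vector_field U y -> vector_field U (mult S U x y).
Proof.
move=> oU UW; apply: vector_field_mult => //.
exact: subset_trans UW (@invertible_locus_dom _ _ _ S).
Qed.

Lemma dual_mult_unit U x y : open U -> U `<=` W ->
  vector_field U x -> vector_field U y ->
  {in U, dual_mult S U (unit_field S) (mult S U x y) =1 dual_mult S U x y}.
Proof.
move=> oU UW xU yU; have eU := unit_vector_field_sub UW.
have mU := vector_field_mult_sub oU UW xU yU.
apply: eq_dual_mult => //.
exact: (mult_unit HS oU (subset_trans UW (@invertible_locus_dom _ _ _ S))).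
Qed.

Lemma dual_mult_unitr U x y : open U -> U `<=` W ->
  vector_field U x -> vector_field U y ->
  {in U, dual_mult S U (mult S U x y) (unit_field S) =1 dual_mult S U x y}.
Proof.
move=> oU UW xU yU p pU; have eU := unit_vector_field_sub UW.
have US := subset_trans UW (@invertible_locus_dom _ _ _ S).
have mU := vector_field_mult_sub oU UW xU yU.
rewrite -(dual_mult_unit oU UW xU yU pU).
apply: eq_dual_mult pU => //; exact: (mult_comm HS oU US).
Qed.

(** At [p], multiplication by the auxiliary field of [D] is the inverse of
multiplication by that of [S]: if [a * w = u * v] with [u] the unit, then
[a * w = v]. *)
Lemma invertible_locus_dual : invertible_locus D = W.
Proof.
apply/seteqP; split=> [p [] |p Wp]; first by rewrite domD.
rewrite /invertible_locus /= domD; split=> //.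
have [Sp [g fK gK]] := Wp.
pose U := W `&` chart_dom (chart_at p).
have oU : open U by exact: openI (invertible_locus_open HS) (chart_dom_open _).
have UW : U `<=` W by exact: subIsetl.
have US := subset_trans UW (@invertible_locus_dom _ _ _ S).
have Up : U p by split => //; exact: chart_at_dom.
have cU v : vector_field U (constant_field p v).
  exact: vector_field_sub (@subIsetr _ _ _) (vector_field_frame _).
have aU := vector_field_sub US (aux_vector_field HS).
have tangentD v : tangent_mult D p (aux_field D p) v = g v.
  have [dU /(_ p (mem_set Up))] :=
    dual_multP HS oU UW (cU (unit_field S p)) (cU v).
  rewrite !(mult_tangent HS) // !constant_field_id tangent_mult1 // => dE.
  by rewrite -[RHS](congr1 g dE) fK /tangent_mult domD multD auxD.
by exists (tangent_mult S p (aux_field S p)) => v; rewrite tangentD ?gK ?fK.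
Qed.

(** [x * y] qualifies as the chosen quotient since [u . (x * y) = x . y].
Conversely, [u . w = x . y] gives [w = u * w = x * y] after multiplication by
[a]. *)
Lemma dual_mult_dual U x y : open U -> U `<=` W ->
  vector_field U x -> vector_field U y ->
  vector_field U (dual_mult D U x y) /\
  {in U, dual_mult D U x y =1 mult S U x y}.
Proof.
move=> oU UW xU yU; have eU := unit_vector_field_sub UW.
have mU := vector_field_mult_sub oU UW xU yU.
have US := subset_trans UW (@invertible_locus_dom _ _ _ S).
have -> : dual_mult D U x y =
    operator_inv U (dual_mult S U (unit_field S)) (dual_mult S U x y).
  by rewrite -multD -auxD.
rewrite /operator_inv; case: xgetP => [w _ [wU ew]|]; last first.
  by move=> /(_ (mult S U x y)) []; split => //; exact: dual_mult_unit.
split => // p pU.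
have aU := vector_field_sub US (aux_vector_field HS).
have [dwU dw] := dual_multP HS oU UW eU wU.
have [dU dxy] := dual_multP HS oU UW xU yU.
rewrite -(dxy p pU) -(mult_unit HS oU US wU pU) -(dw p pU).
by rewrite !(mult_tangent HS) ?ew //; exact: set_mem.
Qed.

(** [dual_mult D] may be replaced by [x * y], and [a^-1 ((x * y) * u)] is
[a^-1 (x * y)]. *)
Lemma dual_mult_dual_unit U x y : open U -> U `<=` W ->
  vector_field U x -> vector_field U y ->
  vector_field U (dual_mult S U (dual_mult D U x y) (unit_field S)) /\
  {in U, dual_mult S U (dual_mult D U x y) (unit_field S) =1
         dual_mult S U x y}.
Proof.
move=> oU UW xU yU; have eU := unit_vector_field_sub UW.
have mU := vector_field_mult_sub oU UW xU yU.
have US := subset_trans UW (@invertible_locus_dom _ _ _ S).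
have [dU dE] := dual_mult_dual oU UW xU yU.
split=> [|p pU]; first by have [] := dual_multP HS oU UW dU eU.
rewrite -(dual_mult_unitr oU UW xU yU pU).
apply: eq_dual_mult pU => //.
have [shS _ _] := mult_multiplication HS.
exact: (eq_op_left shS).
Qed.

Lemma nabla_dual_mult_dual_unit U x y z : open U -> U `<=` W ->
  vector_field U x -> vector_field U y -> vector_field U z ->
  {in U, nabla S U (dual_mult S U (dual_mult D U x y) (unit_field S)) z =1
         nabla S U (dual_mult S U x y) z}.
Proof.
move=> oU UW xU yU zU; have [d2U d2E] := dual_mult_dual_unit oU UW xU yU.
have [dU _] := dual_multP HS oU UW xU yU.
have [shS _ _] := nabla_connection HS.
apply: (eq_op_left shS) => //.
exact: subset_trans UW (@invertible_locus_dom _ _ _ S).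
Qed.

End DualOfDual.

(** * Dualizing twice *)

Section Involution.
Context {K : numFieldType} {n : nat} {M : complexManifold K n}.

Lemma dual_saito_dual_almost_saito (S : tangentStructure M) (r : K) :
  is_tangent_structure S ->
  (forall U x, open U -> U `<=` dom S -> vector_field U x ->
    {in U, nabla S U x (unit_field S) =1 0}) ->
  same_structure (dual_saito (dual_almost_saito r S))
                 (restrict_to (invertible_locus S) S).
Proof.
move=> HS unit_flat; set D := dual_almost_saito r S.
have locusD : invertible_locus D = invertible_locus S.
  exact: invertible_locus_dual.
split=> //= U x y oU; rewrite locusD => UW xU yU p pU.
all: have [dU dE] := dual_mult_dual (D := D) HS erefl erefl oU UW xU yU.
  have US := subset_trans UW (@invertible_locus_dom _ _ _ S).
  have aU := vector_field_sub US (aux_vector_field HS).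
  have [_ d2E] :=
    dual_mult_dual_unit (D := D) HS erefl erefl oU UW xU yU.
  have nablaE :=
    nabla_dual_mult_dual_unit (D := D) HS erefl erefl oU UW xU yU aU.
  rewrite !fctE nablaE // d2E // unit_flat // add0r.
  by rewrite opprB addrA subrK addrK.
exact: dE.
Qed.

Lemma dual_almost_saito_dual_saito (A : tangentStructure M) (r : K) :
  is_tangent_structure A ->
  (forall U x, open U -> U `<=` dom A -> vector_field U x ->
    {in U, nabla A U x (unit_field A) =1 r *: x}) ->
  same_structure (dual_almost_saito r (dual_saito A))
                 (restrict_to (invertible_locus A) A).
Proof.
move=> HA unit_r; set D := dual_saito A.
have locusD : invertible_locus D = invertible_locus A.
  exact: invertible_locus_dual.
split=> //= U x y oU; rewrite locusD => UW xU yU p pU.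
all: have [dU dE] := dual_mult_dual (D := D) HA erefl erefl oU UW xU yU.
  have US := subset_trans UW (@invertible_locus_dom _ _ _ A).
  have aU := vector_field_sub US (aux_vector_field HA).
  have nablaE :=
    nabla_dual_mult_dual_unit (D := D) HA erefl erefl oU UW xU yU aU.
  have unitE : nabla A U (dual_mult D U x y) (unit_field A) p =
      r *: dual_mult D U x y p by exact: unit_r.
  by rewrite !fctE nablaE // unitE opprB addrA addrAC addrK subrK.
exact: dE.
Qed.

End Involution.

Theorem theorem3p11 (R : realType) :
  (forall (n : nat) (M : complexManifold R[i] n) (S : tangentStructure M)
          (r : R[i]),
     dom S = setT -> is_saito S -> invertible_locus S !=set0 ->
     same_structure (dual_saito (dual_almost_saito r S))
                    (restrict_to (invertible_locus S) S)) /\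
  (forall (n : nat) (N : complexManifold R[i] n) (A : tangentStructure N)
          (r : R[i]),
     dom A = setT -> is_almost_saito r A -> invertible_locus A !=set0 ->
     same_structure (dual_almost_saito r (dual_saito A))
                    (restrict_to (invertible_locus A) A)).
Proof.
split=> [n M S r _ HS _|n N A r _ HA _].
  exact: dual_saito_dual_almost_saito (saito_base HS) (saito_unit_flat HS).
exact: dual_almost_saito_dual_saito (almost_saito_base HA)
  (almost_saito_unit HA).
Qed.
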